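(* Let $\Pi_n$ be a permutation of $[n]=\{1,\dots,n\}$ chosen uniformly at random from all $n!$ permutations. Then there exist constants $c, C>0$ such that \[ \lim_{n\to\infty}{\mathds P}\left( c\,\frac{n^{2/3}}{(\log n)^{1/3}} \le t(\Pi_n) \le C\, n^{2/3}\right)=1, \] i.e. asymptotically almost surely $t(\Pi_n)=\Omega\!\left(n^{2/3}/\log^{1/3} n\right)$ and $t(\Pi_n)=O(n^{2/3})$.
   Context: A permutation is any finite sequence of distinct positive integers; an $n$-permutation is a permutation of $[n]$. Two permutations $(x_1,\dots,x_k)$ and $(y_1,\dots,y_k)$ are similar if $x_i<x_j \iff y_i<y_j$ for all $1\le i<j\le k$. For a permutation $\pi=(\pi(1),\dots,\pi(n))$, a sub-permutation is a subsequence $(\pi(i_1),\dots,\pi(i_k))$ with $i_1<\dots<i_k$. A pair of twins in $\pi$ is a pair of similar sub-permutations of $\pi$ whose index sets are disjoint; its length is the common number $k$ of entries of each of the two sub-permutations. $t(\pi)$ denotes the largest length of a pair of twins in $\pi$. *)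

(* Defs.v *)
From HB Require Import structures.
From mathcomp Require Import all_boot all_order all_algebra all_fingroup.
From mathcomp Require Import all_classical all_reals all_analysis.
Set Implicit Arguments. Unset Strict Implicit. Unset Printing Implicit Defensive.
Import Order.TTheory GRing.Theory Num.Theory.
Import numFieldNormedType.Exports.

Definition similar (k : nat) (x y : 'I_k -> nat) : bool :=
  [forall i : 'I_k, forall j : 'I_k,
    (i < j)%N ==> ((x i < x j)%N == (y i < y j)%N)].

Definition increasing (k n : nat) (f : 'I_k -> 'I_n) : bool :=
  [forall i : 'I_k, forall j : 'I_k, (i < j)%N ==> (f i < f j)%N].

(* Positions and values are both numbered 0, ..., n-1 instead of 1, ..., n. *)
Definition subperm (n k : nat) (pi : 'S_n) (f : 'I_k -> 'I_n) : 'I_k -> nat :=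
  fun i => nat_of_ord (pi (f i)).

(* f and g list the two index sets in increasing order. *)
Definition is_twins (n k : nat) (pi : 'S_n) (f g : 'I_k -> 'I_n) : bool :=
  [&& increasing f, increasing g,
      [forall i : 'I_k, forall j : 'I_k, f i != g j] &
      similar (subperm pi f) (subperm pi g)].

Definition has_twins (n : nat) (pi : 'S_n) (k : nat) : bool :=
  [exists f : {ffun 'I_k -> 'I_n}, exists g : {ffun 'I_k -> 'I_n},
    is_twins pi f g].

(* The bound k <= n loses nothing: an index list is injective into 'I_n.
   Empty twins always exist, so the maximum is attained. *)
Definition twin_length (n : nat) (pi : 'S_n) : nat :=
  \max_(k < n.+1 | has_twins pi k) k.

Local Open Scope ring_scope.

Definition uniform_proba (R : realType) (T : finType) (E : pred T) : R :=
  #|E|%:R / #|T|%:R.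

(* Main.v *)
(** Upper bound: for fixed index sets f and g of size k, rearranging the entries
    of pi at g in all k! ways gives disjoint events, so f and g carry twins with
    probability at most 1/k!. Hence twins of length k exist with probability at
    most n^(2k) / k!^3 <= (64 n^2 / k^3)^k.

    Lower bound: cut positions and values into blocks of length
    b ~ n^(1/3) / (log n)^(1/6), and call a pair of positions good if it lies in
    one position block and its values lie in one value block. Good pairs whose
    position blocks and value blocks are all distinct form twins: take the left
    points for one twin and the right points for the other. A random permutation
    has about b^2/2 good pairs (second moment method), while the expected number
    of pairs of good pairs sharing a position block or a value block is
    O(b^5 / n) = o(b^2); deleting the good pairs involved in such conflicts leaves
    twins of length of order b^2. *)
From mathcomp Require Import all_boot all_order all_algebra all_fingroup.
From mathcomp Require Import zify ring lra.
Require Import Defs.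
Set Implicit Arguments. Unset Strict Implicit. Unset Printing Implicit Defensive.

(** * Images of a fixed tuple under a uniform permutation *)

(** Induction on the length: a permutation matching the tails is composed with the transposition of
    [sigma x] and [y], which moves no entry of the tail of [t]. *)
Lemma perm_map_exists (T : finType) (s t : seq T) :
  size s = size t -> uniq s -> uniq t -> exists sigma : {perm T}, map sigma s = t.
Proof.
elim: s t => [|x s IHs] [|y t] //=; first by exists (1%g).
case=> eq_st /andP[xNs us] /andP[yNt ut].
have [sigma def_t] := IHs t eq_st us ut.
exists (sigma * tperm (sigma x) y)%g; rewrite permM tpermL -def_t; congr cons.
apply/eq_in_map => z zs; rewrite permM tpermD //.
  by rewrite (inj_eq perm_inj); apply: contraNneq xNs => ->.
by apply: contraNneq yNt => ->; rewrite -def_t map_f.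
Qed.

Lemma card_permT (T : finType) : #|{perm T}| = #|T|`!.
Proof.
rewrite -[in RHS]cardsT -card_perm; apply: eq_card => pi.
by rewrite inE; apply/esym/subsetP => x _; rewrite inE.
Qed.

(** The image of a fixed duplicate-free tuple is uniform among all duplicate-free tuples. The proof
    counts the pairs of a permutation [pi] and a duplicate-free [y] with [Q (map_tuple pi y)] in two
    ways: the count over [pi] is the same for every [y], by translation in the group, and the count
    over [y] is the same for every [pi], which acts injectively on tuples. *)
Lemma card_perm_map (T : finType) r (s : r.-tuple T) (Q : pred (r.-tuple T)) :
  uniq s ->
  #|[set pi : {perm T} | Q (map_tuple pi s)]| * #|T| ^_ r =
  #|T|`! * #|[set y : r.-tuple T | uniq y & Q y]|.
Proof.
move=> us.
have card_uniq : #|[set y : r.-tuple T | uniq y]| = #|T| ^_ r.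
  rewrite -(card_uniq_tuples r (pred_of_simpl (@predT T))); apply: eq_card => y.
  by rewrite !inE all_predT.
have same_card (y : r.-tuple T) : uniq y ->
    #|[set pi : {perm T} | Q (map_tuple pi y)]| =
    #|[set pi : {perm T} | Q (map_tuple pi s)]|.
  move=> uy; have [|sigma def_y] := perm_map_exists _ us uy.
    by rewrite !size_tuple.
  rewrite -[RHS](card_preimset _ (mulgI sigma)); apply: eq_card => pi.
  rewrite !inE; congr (Q _); apply/val_inj; rewrite /= -def_y -map_comp.
  by apply: eq_map => x /=; rewrite permM.
rewrite -card_uniq mulnC -sum_nat_const.
have -> : \sum_(y in [set y : r.-tuple T | uniq y])
      #|[set pi : {perm T} | Q (map_tuple pi s)]| =
    \sum_(y : r.-tuple T | uniq y) \sum_(pi : {perm T} | Q (map_tuple pi y)) 1.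
  apply: eq_big => [y|y]; rewrite !inE // => uy.
  by rewrite -(same_card y uy) -sum1_card; apply: eq_bigl => pi; rewrite inE.
rewrite (exchange_big_dep xpredT) //=.
rewrite -card_permT -sum_nat_const.
apply: eq_bigr => pi _; rewrite sum1dep_card.
have inj_pi : injective (map_tuple (n := r) pi).
  by move=> y z /(congr1 val) /= /(inj_map perm_inj) yz; apply/val_inj.
rewrite -[RHS](card_preimset _ inj_pi); apply: eq_card => y.
by rewrite !inE (map_inj_uniq (@perm_inj _ pi)).
Qed.

(** * The upper bound *)

Lemma increasingP k n (f : 'I_k -> 'I_n) :
  reflect {homo f : i j / i < j} (increasing f).
Proof.
apply: (iffP forallP) => [f_inc i j ij|f_inc i].
  by have /forallP/(_ j)/implyP := f_inc i; apply.
by apply/forallP => j; apply/implyP; apply: f_inc.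
Qed.

Lemma increasing_inj k n (f : 'I_k -> 'I_n) : increasing f -> injective f.
Proof.
move=> /increasingP f_inc i j fij; apply/val_inj => /=.
by case: (ltngtP i j) => // /f_inc; rewrite fij ltnn.
Qed.

(** Without ties, the comparison of a pair with [i > j] is the negation of the comparison for
    [j < i], so the restriction to [i < j] in [similar] costs nothing. *)
Lemma similarP k (x y : 'I_k -> nat) : injective x -> injective y ->
  reflect (forall i j, (x i < x j) = (y i < y j)) (similar x y).
Proof.
move=> xI yI; apply: (iffP forallP) => [sim i j|sim i]; last first.
  by apply/forallP => j; rewrite sim eqxx implybT.
have simE (u v : 'I_k) : u < v -> (x u < x v) = (y u < y v).
  by move=> uv; have /forallP/(_ v)/implyP/(_ uv)/eqP := sim u.
case: (ltngtP i j) => [|ji|/val_inj ->]; [exact: simE| |by rewrite !ltnn].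
have xij : x i != x j by rewrite (inj_eq xI) -val_eqE /= gtn_eqF.
have yij : y i != y j by rewrite (inj_eq yI) -val_eqE /= gtn_eqF.
by have := simE _ _ ji; lia.
Qed.

(** Similarity to [x] fixes the rank of [z (s i)] among the values of [z]: it is the number of [j]
    with [x j < x i]. Since [z] is injective, the rank determines [s i]. *)
Lemma similar_perm_unique k (x z : 'I_k -> nat) (s t : 'S_k) :
  injective x -> injective z ->
  similar x (z \o s) -> similar x (z \o t) -> s = t.
Proof.
move=> xI zI xs xt.
have comp_inj (u : 'S_k) : injective (z \o u) by apply: inj_comp => //; apply: perm_inj.
have {xs}xs := elimT (similarP xI (comp_inj s)) xs.
have {xt}xt := elimT (similarP xI (comp_inj t)) xt.
have st i j : (z (s i) < z (s j)) = (z (t i) < z (t j)) by rewrite -[LHS]xs -[RHS]xt.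
pose rank (a : 'I_k) := #|[set l | z l < z a]|.
have rank_mono a c : z a < z c -> rank a < rank c.
  move=> ac; apply/proper_card/properP; split.
    by apply/subsetP => l; rewrite !inE => /ltn_trans; apply.
  by exists a; rewrite inE ?ltnn.
have rank_inj : injective rank.
  move=> a c rac; apply: zI.
  by case: (ltngtP (z a) (z c)) => // /rank_mono; rewrite rac ltnn.
apply/permP => i; apply: rank_inj.
rewrite /rank -(card_preimset _ (@perm_inj _ s)) -[RHS](card_preimset _ (@perm_inj _ t)).
by apply: eq_card => j; rewrite !inE st.
Qed.

Lemma subperm_inj n k (pi : 'S_n) (f : 'I_k -> 'I_n) :
  injective f -> injective (subperm pi f).
Proof. by move=> fI i j /val_inj /perm_inj /fI. Qed.

(** The events [E s], in which the entries at [g] are rearranged by [s] before the comparison with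
    those at [f], are equally large and pairwise disjoint, and there are [k!] of them. *)
Lemma card_is_twins n k (f g : 'I_k -> 'I_n) :
  #|[set pi | is_twins pi f g]| * k`! <= n`!.
Proof.
have [/and3P[f_inc g_inc /forallP fg]|noc] :=
    boolP [&& increasing f, increasing g &
              [forall i : 'I_k, forall j : 'I_k, f i != g j]]; last first.
  rewrite (_ : [set pi | _] = set0) ?cards0 //; apply/setP => pi; rewrite !inE.
  by apply/negbTE; apply: contra noc => /and4P[-> -> ->].
have fI := increasing_inj f_inc; have gI := increasing_inj g_inc.
pose E (s : 'S_k) := [set pi : 'S_n | similar (subperm pi f) (subperm pi (g \o s))].
have [e e_uniq e_all] : exists2 e : seq 'I_k, uniq e & forall i, i \in e.
  by exists (enum 'I_k) => [|i]; rewrite ?enum_uniq ?mem_enum.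
have uniq_fg (s : 'S_k) : uniq (map f e ++ map (g \o s) e).
  rewrite cat_uniq; apply/and3P; split.
  - by rewrite map_inj_uniq ?e_uniq.
  - apply/negP => /hasP[_ /mapP[i _ ->] /mapP[j _ /eqP]].
    by rewrite eq_sym; have /forallP/(_ (s i))/negbTE -> := fg j.
  - rewrite map_inj_uniq ?e_uniq //.
    by apply: inj_comp => //; apply: perm_inj.
(* Left translation by a permutation [tau] that fixes the positions [f i] and sends [g i] to
   [g (s i)] carries one event to the other. *)
have card_E s : #|E 1%g| = #|E s|.
  have [|tau] := perm_map_exists _ (uniq_fg 1%g) (uniq_fg s).
    by rewrite !size_cat !size_map.
  rewrite map_cat => /eqP; rewrite eqseq_cat ?size_map // -!map_comp.
  case/andP => /eqP/eq_in_map tau_f /eqP/eq_in_map tau_g.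
  rewrite -[LHS](card_preimset _ (mulgI tau)); apply: eq_card => pi; rewrite !inE.
  rewrite /similar; apply: eq_forallb => i; apply: eq_forallb => j.
  have tf l : tau (f l) = f l by apply: tau_f.
  have tg l : tau (g l) = g (s l).
    by have /= <- := tau_g l (e_all l); rewrite perm1.
  by rewrite /subperm /= !permM !perm1 !tf !tg.
have subE : [set pi | is_twins pi f g] \subset E 1%g.
  apply/subsetP => pi; rewrite !inE => /and4P[_ _ _].
  congr is_true; rewrite /similar; apply: eq_forallb => i; apply: eq_forallb => j.
  by rewrite /subperm /= !perm1.
apply: leq_trans (leq_mul (subset_leq_card subE) (leqnn _)) _.
rewrite -(card_Sn k) mulnC -sum_nat_const.
under eq_bigr => s _ do rewrite (card_E s) -sum1_card.
(* After exchanging the sums, disjointness of the events says that each [pi] is counted at most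
   once. *)
rewrite (exchange_big_dep xpredT) //= -card_Sn -[leqRHS]sum1_card.
apply: leq_sum => pi _; rewrite sum1dep_card.
apply/card_le1P => s; rewrite !inE => s_sim t; rewrite !inE.
apply/idP/eqP => [t_sim|->//].
exact: similar_perm_unique (subperm_inj fI) (subperm_inj gI) t_sim s_sim.
Qed.

Lemma card_bigcup_le (I T : finType) (A : {set I}) (F : I -> {set T}) :
  #|\bigcup_(i in A) F i| <= \sum_(i in A) #|F i|.
Proof.
elim/big_rec2: _ => [|i m B _ IH]; first by rewrite cards0.
by apply: leq_trans (leq_card_setU _ _) _; rewrite leq_add2l.
Qed.

Lemma ffact_le_expn n k : n ^_ k <= n ^ k.
Proof.
elim: k => // k IHk; rewrite ffactnSr expnSr leq_mul //; exact: leq_subr.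
Qed.

(** An increasing [f] is a strictly sorted tuple of values, so the count is at most a binomial
    coefficient. *)
Lemma card_increasing n k :
  #|[set f : {ffun 'I_k -> 'I_n} | increasing f]| * k`! <= n ^ k.
Proof.
apply: leq_trans (ffact_le_expn _ _); rewrite -bin_ffact leq_mul2r.
apply/orP; right; rewrite -card_ltn_sorted_tuples.
pose h (f : {ffun 'I_k -> 'I_n}) := [tuple f i | i < k].
have h_inj : injective h.
  by move=> f1 f2 /(congr1 (@tnth _ _)) h12; apply/ffunP => i;
    have := congr1 (@^~ i) h12; rewrite !tnth_mktuple.
rewrite -(card_imset _ h_inj); apply: subset_leq_card.
apply/subsetP => _ /imsetP[f + ->]; rewrite !inE => /increasingP f_inc.
rewrite /= -map_comp; apply: (homo_sorted (e := relpre val ltn)) => [i j|].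
  exact: f_inc.
by rewrite -sorted_map val_enum_ord iota_ltn_sorted.
Qed.

(** Union bound over the index lists: one factor [k!] comes from each of the two choices of an
    increasing list, and the third from [card_is_twins]. *)
Lemma card_has_twins n k :
  #|[set pi : 'S_n | has_twins pi k]| * k`! ^ 3 <= n`! * n ^ k.*2.
Proof.
pose I := [set f : {ffun 'I_k -> 'I_n} | increasing f].
have cardI : #|I| * k`! <= n ^ k by apply: card_increasing.
have cardT : #|[set pi : 'S_n | has_twins pi k]| * k`! <= #|I| * #|I| * n`!.
  have sub : [set pi : 'S_n | has_twins pi k] \subset
      \bigcup_(fg in setX I I) [set pi | is_twins pi fg.1 fg.2].
    apply/subsetP => pi; rewrite inE => /existsP[f /existsP[g tw]].
    apply/bigcupP; exists (f, g); rewrite !inE //.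
    by have /and4P[-> ->] := tw.
  apply: leq_trans (leq_mul (subset_leq_card sub) (leqnn _)) _.
  apply: leq_trans (leq_mul (card_bigcup_le _ _) (leqnn _)) _.
  rewrite -cardsX -sum_nat_const big_distrl /=.
  by apply: leq_sum => fg _; apply: card_is_twins.
rewrite -addnn expnD (expnS _ 2) -mulnn mulnA.
apply: leq_trans (leq_mul cardT (leqnn _)) _.
rewrite [leqLHS](_ : _ = n`! * ((#|I| * k`!) * (#|I| * k`!))); last by lia.
by rewrite leq_mul2l leq_mul ?orbT.
Qed.

(** Twins are truncated to their first [l] entries. This monotonicity lets the maximum in
    [twin_length] be read as a threshold. *)
Lemma has_twinsW n (pi : 'S_n) k l : l <= k -> has_twins pi k -> has_twins pi l.
Proof.
move=> lk /existsP[f /existsP[g /and4P[/increasingP f_inc /increasingP g_inc fg sim]]].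
apply/existsP; exists [ffun i => f (widen_ord lk i)].
apply/existsP; exists [ffun i => g (widen_ord lk i)].
apply/and4P; split.
- by apply/increasingP => i j ij; rewrite !ffunE; apply: f_inc.
- by apply/increasingP => i j ij; rewrite !ffunE; apply: g_inc.
- apply/forallP => i; apply/forallP => j; rewrite !ffunE.
  by have /forallP/(_ (widen_ord lk i))/forallP := fg; apply.
- apply/forallP => i; apply/forallP => j; rewrite /subperm !ffunE.
  by have /forallP/(_ (widen_ord lk i))/forallP := sim; apply.
Qed.

Lemma leq_twin_length n (pi : 'S_n) k : (k <= twin_length pi) = has_twins pi k.
Proof.
apply/idP/idP => [k_le|tw].
  apply: has_twinsW k_le _.
  have tw0 : has_twins pi (@ord0 n).
    apply/existsP; exists [ffun i => widen_ord (leq0n n) i].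
    apply/existsP; exists [ffun i => widen_ord (leq0n n) i].
    by apply/and4P; split; apply/forallP => -[].
  rewrite /twin_length.
  have ne : 0 < #|[pred j : 'I_n.+1 | has_twins pi j]|.
    by apply/card_gt0P; exists ord0.
  by have [j tw ->] := eq_bigmax_cond (fun j : 'I_n.+1 => val j) ne.
have kn : k < n.+1.
  have /existsP[f /existsP[g /and4P[f_inc _ _ _]]] := tw.
  by have := leq_card f (increasing_inj f_inc); rewrite !card_ord.
exact: (@leq_bigmax_cond _ _ (fun j : 'I_n.+1 => val j) (Ordinal kn)).
Qed.

(** The falling factorial of [2k] of length [k] has all factors above [k], and it equals [k!] times
    a central binomial coefficient, which is one term in the expansion of [(1 + 1) ^ (2k)]. *)
Lemma expn_self_le_fact k : k ^ k <= 4 ^ k * k`!.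
Proof.
apply: (@leq_trans (k.*2 ^_ k)).
  suff ffact_ge m j : j <= m -> (m - j) ^ j <= m ^_ j.
    by have := @ffact_ge k.*2 k; rewrite -addnn addnK; apply; apply: leq_addl.
  elim: j => // j IHj jm; rewrite ffactnSr expnSr leq_mul //; last by lia.
  apply: leq_trans (IHj _); last by lia.
  by case: (posnP j) => [->//|j_gt0]; rewrite leq_exp2r //; lia.
rewrite -bin_ffact leq_mul2r; apply/orP; right.
rewrite -[4]/(2 ^ 2) -expnM mul2n -[2]/(1 + 1) expnDn.
have kk : k < k.*2.+1 by rewrite -addnn ltnS leq_addl.
by rewrite (bigD1 (Ordinal kk)) //= !exp1n !muln1 leq_addr.
Qed.

(** By [expn_self_le_fact], [k!^3] is at least [(k^3 / 64)^k], hence at least [(2 n^2)^k]. The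
    constant 128 is 2 times 64: the spare factor 2 gives the decay [2^-k]. *)
Lemma card_twin_length_ge n k : 0 < n -> 128 * n ^ 2 <= k ^ 3 ->
  #|[set pi : 'S_n | k <= twin_length pi]| * 2 ^ k <= n`!.
Proof.
move=> n_gt0 nk; have := card_has_twins n k.
rewrite (eq_card (B := [set pi : 'S_n | k <= twin_length pi])); last first.
  by move=> pi; rewrite !inE leq_twin_length.
set E := #|_| => twE.
have nk' : (128 * n ^ 2) ^ k <= (k ^ 3) ^ k by case: (k) nk => // j; rewrite leq_exp2r.
have le1 : E * (k ^ 3) ^ k <= E * (4 ^ k * k`!) ^ 3.
  by rewrite leq_mul2l -expnM mulnC expnM leq_exp2r // expn_self_le_fact orbT.
rewrite -(leq_pmul2r (_ : 0 < 64 ^ k * n ^ k.*2)) ?muln_gt0 ?expn_gt0 ?n_gt0 //.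
have e1 : (128 * n ^ 2) ^ k = 2 ^ k * 64 ^ k * n ^ k.*2.
  by rewrite expnMn -expnM mul2n -[128]/(2 * 64) expnMn.
have e2 : (4 ^ k * k`!) ^ 3 = 64 ^ k * k`! ^ 3.
  by rewrite expnMn -expnM (mulnC k) expnM.
rewrite e1 in nk'; rewrite e2 in le1.
have le2 := leq_trans (leq_mul (leqnn E) nk') le1.
have le3 := leq_mul (leqnn (64 ^ k)) twE.
rewrite -mulnA [2 ^ k * _]mulnA; apply: leq_trans le2 _.
rewrite mulnCA; apply: leq_trans le3 _.
by rewrite mulnCA.
Qed.

(** * Twins from good pairs *)

Definition same_block b n (i j : 'I_n) : bool := i %/ b == j %/ b.

Definition close_pairs b n : {set 'I_n * 'I_n} :=
  [set e : 'I_n * 'I_n | (e.1 < e.2) && same_block b e.1 e.2].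

Definition good_pairs b n (pi : 'S_n) : {set 'I_n * 'I_n} :=
  [set e in close_pairs b n | same_block b (pi e.1) (pi e.2)].

(** Comparing first components suffices for good pairs, whose two points share both their position
    block and their value block. *)
Definition conflict b n (pi : 'S_n) (e f : 'I_n * 'I_n) : bool :=
  (e != f) && (same_block b e.1 f.1 || same_block b (pi e.1) (pi f.1)).

Definition conflicts b n (pi : 'S_n) : {set ('I_n * 'I_n) * ('I_n * 'I_n)} :=
  [set ef in setX (good_pairs b pi) (good_pairs b pi) | conflict b pi ef.1 ef.2].

(** Division by [b] is monotone, so points in different blocks are ordered as their blocks are, and
    moving each within its own block changes nothing. *)
Lemma ltn_divn_block b n (i j i' j' : 'I_n) : same_block b i i' -> same_block b j j' ->
  ~~ same_block b i j -> (i' < j') = (i < j).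
Proof.
rewrite /same_block => /eqP ii /eqP jj ij.
case: (ltngtP i j) => [lij|lji|e]; last by rewrite e eqxx in ij.
- have := leq_div2r b (ltnW lij) => le; apply/negPn; rewrite -leqNgt; apply/negP.
  by move/(leq_div2r b); lia.
- by have := leq_div2r b (ltnW lji) => le; apply/negP => /ltnW/(leq_div2r b); lia.
Qed.

Lemma has_twins_conflict_free b n (pi : 'S_n) (H : {set 'I_n * 'I_n}) :
  H \subset good_pairs b pi -> {in H &, forall e f, ~~ conflict b pi e f} ->
  has_twins pi #|H|.
Proof.
move=> /subsetP Hgood free.
have blocks e f : e \in H -> f \in H -> e != f ->
    ~~ same_block b e.1 f.1 /\ ~~ same_block b (pi e.1) (pi f.1).
  by move=> eH fH ef; have := free e f eH fH; rewrite /conflict ef negb_or => /andP.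
(* The pairs are indexed by their left points, which are distinct by conflict-freeness, because the
   enumeration of a set of ordinals is increasing. *)
pose A := [set e.1 | e in H].
have <- : #|A| = #|H|.
  apply: card_in_imset => e f eH fH ef; apply/eqP/negPn/negP => nef.
  by have [] := blocks e f eH fH nef; rewrite ef /same_block eqxx.
(* [g i] is the right partner of [i]; the default is never reached for [i] in [A]. *)
pose g i := odflt i (omap snd [pick e in H | e.1 == i]).
have gP i : i \in A -> (i, g i) \in H.
  case/imsetP => e eH ->; rewrite /g; case: pickP => [[e1 e2] /andP[/= eH' /eqP <-] //|].
  by move/(_ e); rewrite /= eH eqxx.
have goodP i : i \in A ->
    [/\ i < g i, same_block b i (g i) & same_block b (pi i) (pi (g i))].
  by move=> /gP/Hgood; rewrite !inE /= => /andP[/andP[-> ->] ->].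
have fA (i : 'I_#|A|) : enum_val i \in A by apply: enum_valP.
have f_inc (i j : 'I_#|A|) : i < j -> (enum_val i : 'I_n) < enum_val j.
  move=> ij; rewrite (enum_val_nth (enum_val i)) (enum_val_nth (enum_val i) j).
  pose x0 : 'I_n := enum_val i.
  have s : sorted (relpre val ltn) (enum A).
    rewrite /enum_mem -enumT; apply: sorted_filter => [? ? ?|]; first exact: ltn_trans.
    by rewrite -sorted_map val_enum_ord iota_ltn_sorted.
  have tr : transitive (relpre (@nat_of_ord n) ltn) by move=> ? ? ?; apply: ltn_trans.
  by apply: (sorted_ltn_nth tr x0 s) => //; rewrite inE -cardE.
have neq (i j : 'I_#|A|) : i < j -> (enum_val i, g (enum_val i)) != (enum_val j, g (enum_val j)).
  by move=> /f_inc; apply: contraTneq => -[->]; rewrite ltnn.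
have sep (i j : 'I_#|A|) : i < j ->
   ~~ same_block b (enum_val i) (enum_val j) /\
   ~~ same_block b (pi (enum_val i)) (pi (enum_val j)).
  by move=> /neq/(blocks _ _ (gP _ (fA i)) (gP _ (fA j))).
have sep' (i j : 'I_#|A|) : i != j -> ~~ same_block b (enum_val i) (enum_val j).
  case: (ltngtP i j) => [/sep[]//|/sep[]|/val_inj ->]; last by rewrite eqxx.
  by rewrite /same_block eq_sym.
apply/existsP; exists [ffun i => enum_val i].
apply/existsP; exists [ffun i => g (enum_val i)].
apply/and4P; split.
- by apply/increasingP => i j ij; rewrite !ffunE; apply: f_inc.
- apply/increasingP => i j ij; rewrite !ffunE.
  have [_ bi _] := goodP _ (fA i); have [_ bj _] := goodP _ (fA j).
  by rewrite (ltn_divn_block bi bj) ?f_inc //; case: (sep i j ij).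
(* Disjointness: a right point differs from its own left point by [i < g i], and from the other left
   points because it lies in another block. *)
- apply/forallP => i; apply/forallP => j; rewrite !ffunE.
  have [-> | ij] := eqVneq i j.
    by have [+ _ _] := goodP _ (fA j); rewrite -val_eqE /=; lia.
  apply: contra (sep' _ _ ij) => /eqP ->.
  by have [_ + _] := goodP _ (fA j); rewrite /same_block eq_sym.
- apply/forallP => i; apply/forallP => j; apply/implyP => ij.
  rewrite /subperm !ffunE.
  have [_ _ bi] := goodP _ (fA i); have [_ _ bj] := goodP _ (fA j).
  by rewrite (ltn_divn_block bi bj) //; case: (sep i j ij).
Qed.

(** Deletion: the good pairs free of conflicts form twins, and every other good pair is the first
    component of some ordered conflict. *)
Lemma card_good_pairs_le b n (pi : 'S_n) :
  #|good_pairs b pi| <= twin_length pi + #|conflicts b pi|.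
Proof.
pose H := [set e in good_pairs b pi | [forall f in good_pairs b pi, ~~ conflict b pi e f]].
have tw : #|H| <= twin_length pi.
  rewrite leq_twin_length; apply: (@has_twins_conflict_free b).
    by apply/subsetP => e; rewrite inE => /andP[].
  move=> e f; rewrite ![_ \in H]inE => /andP[_ /forall_inP free] /andP[fg _].
  exact: free.
rewrite -(cardsID H) leq_add //.
  apply: leq_trans tw; apply: subset_leq_card; exact: subsetIr.
apply: leq_trans (leq_imset_card fst _); apply: subset_leq_card.
apply/subsetP => e; rewrite in_setD => /andP[eH eg].
move: eH; rewrite inE eg /= negb_forall_in => /exists_inP[f fg].
rewrite negbK => ef; apply/imsetP; exists (e, f) => //.
by rewrite inE in_setX eg fg.
Qed.

Definition clusters b n r : {set r.+1.-tuple 'I_n} :=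
  [set y | all (same_block b (thead y)) y].

(** A cluster is determined by its first entry, which fixes the block, and by the residues modulo
    [b] of the other [r] entries. *)
Lemma card_clusters b n r : 0 < b -> #|clusters b n r| <= n * b ^ r.
Proof.
move=> b_gt0.
pose md (i : 'I_n) : 'I_b := Ordinal (ltn_pmod i b_gt0).
pose h (y : r.+1.-tuple 'I_n) := (thead y, map_tuple md (behead_tuple y)).
rewrite -[leqRHS](_ : #|{: 'I_n * r.-tuple 'I_b}| = _); last first.
  by rewrite card_prod card_tuple !card_ord.
have h_inj : {in clusters b n r &, injective h}.
  move=> y z; case: (tupleP y) => x s; case: (tupleP z) => x' s'.
  rewrite !inE !theadE /= => /andP[_ xs] /andP[_ xs']; rewrite /h !theadE => -[e es].
  subst x'; apply/val_inj => /=; congr cons.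
  apply: (@eq_from_nth _ x); first by rewrite !size_tuple.
  move=> i i_s; have i_s' : i < size s' by rewrite size_tuple -(size_tuple s).
  have := congr1 (fun t => nth (md x) t i) es; rewrite !(nth_map x) //=.
  move=> /(congr1 val) /= mi; apply/val_inj.
  have /eqP d1 := all_nthP x xs i i_s; have /eqP d2 := all_nthP x xs' i i_s'.
  by rewrite /= (divn_eq (nth x s i) b) (divn_eq (nth x s' i) b) -d1 -d2 mi.
rewrite -(card_in_imset h_inj); exact: max_card.
Qed.

(** * Moments of good pairs and conflicts *)

(** Both orders are allowed, unlike in [close_pairs], because the two values of a good pair may come
    in either order. *)
Definition block_mates b n : {set 'I_n * 'I_n} :=
  [set e : 'I_n * 'I_n | (e.1 != e.2) && same_block b e.1 e.2].

Lemma card_perm_map_le n r (s : r.-tuple 'I_n) (B : {set r.-tuple 'I_n}) : uniq s ->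
  #|[set pi : 'S_n | map_tuple pi s \in B]| * n ^_ r <= n`! * #|B|.
Proof.
move=> us; have := card_perm_map (mem B) us; rewrite card_ord => ->.
by rewrite leq_mul2l subset_leq_card ?orbT //; apply/subsetP => y; rewrite inE => /andP[].
Qed.

(** An equality rather than a bound, because the variance estimate needs the exact mean number of
    good pairs. *)
Lemma card_perm_block2 b n (x y : 'I_n) : x != y ->
  #|[set pi : 'S_n | same_block b (pi x) (pi y)]| * n ^_ 2 = n`! * #|block_mates b n|.
Proof.
move=> xy; have us : uniq [tuple x; y] by rewrite /= inE xy.
pose Q (t : 2.-tuple 'I_n) := if val t is [:: u; v] then same_block b u v else false.
have := card_perm_map Q us; rewrite card_ord => ->; congr (_ * _).
pose h (e : 'I_n * 'I_n) := [tuple e.1; e.2].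
have h_inj : injective h by move=> [u v] [u' v'] /(congr1 val)[-> ->].
rewrite -(card_imset _ h_inj); apply: eq_card => t; rewrite !inE.
apply/idP/imsetP => [|[[u v]]].
  case: t => -[|u [|v []]] // sz /andP[/= + bl]; rewrite inE andbT => uv.
  by exists (u, v); [rewrite inE uv | apply: val_inj].
by rewrite inE => /andP[/= uv bl] -> /=; rewrite inE uv.
Qed.

Lemma card_perm_block3 b n (x y z : 'I_n) : 0 < b -> uniq [:: x; y; z] ->
  #|[set pi : 'S_n | same_block b (pi x) (pi y) && same_block b (pi x) (pi z)]| * n ^_ 3
    <= n`! * (n * b ^ 2).
Proof.
move=> b_gt0 us.
apply: leq_trans (leq_mul (leqnn _) (card_clusters n 2 b_gt0)).
apply: leq_trans (@card_perm_map_le _ _ [tuple x; y; z] (clusters b n 2) us).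
rewrite leq_mul2r subset_leq_card ?orbT //; apply/subsetP => pi.
by rewrite !inE /thead (tnth_nth (pi x)) /= /same_block eqxx andbT.
Qed.

Lemma card_perm_block4 b n (x y z w : 'I_n) : 0 < b -> uniq [:: x; y; z; w] ->
  #|[set pi : 'S_n | [&& same_block b (pi x) (pi y), same_block b (pi x) (pi z) &
                         same_block b (pi x) (pi w)]]| * n ^_ 4
    <= n`! * (n * b ^ 3).
Proof.
move=> b_gt0 us.
apply: leq_trans (leq_mul (leqnn _) (card_clusters n 3 b_gt0)).
apply: leq_trans (@card_perm_map_le _ _ [tuple x; y; z; w] (clusters b n 3) us).
rewrite leq_mul2r subset_leq_card ?orbT //; apply/subsetP => pi.
by rewrite !inE /thead (tnth_nth (pi x)) /= /same_block eqxx andbT.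
Qed.

(** The four values form two block mates. Counting all couples of block mates, even overlapping
    ones, is accurate enough for the leading term of the second moment. *)
Lemma card_perm_block22 b n (x y z w : 'I_n) : uniq [:: x; y; z; w] ->
  #|[set pi : 'S_n | same_block b (pi x) (pi y) && same_block b (pi z) (pi w)]| * n ^_ 4
    <= n`! * #|block_mates b n| ^ 2.
Proof.
move=> us.
pose h (ef : ('I_n * 'I_n) * ('I_n * 'I_n)) := [tuple ef.1.1; ef.1.2; ef.2.1; ef.2.2].
pose B := h @: setX (block_mates b n) (block_mates b n).
apply: (@leq_trans (n`! * #|B|)); last first.
  by rewrite leq_mul2l -mulnn -cardsX leq_imset_card orbT.
apply: leq_trans (@card_perm_map_le _ _ [tuple x; y; z; w] B us).
rewrite leq_mul2r subset_leq_card ?orbT //; apply/subsetP => pi; rewrite !inE => /andP[xy zw].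
apply/imsetP; exists ((pi x, pi y), (pi z, pi w)); last exact: val_inj.
rewrite !inE /= !(inj_eq perm_inj) xy zw !andbT.
by move: us; rewrite /= !inE !negb_or => /and4P[/and3P[-> _ _] _ -> _].
Qed.

Notation all4 ef := [:: ef.1.1; ef.1.2; ef.2.1; ef.2.2].

Definition overlapping b n : {set ('I_n * 'I_n) * ('I_n * 'I_n)} :=
  [set ef in setX (close_pairs b n) (close_pairs b n) | (ef.1 != ef.2) && ~~ uniq (all4 ef)].

Definition disjoint_pairs b n : {set ('I_n * 'I_n) * ('I_n * 'I_n)} :=
  [set ef in setX (close_pairs b n) (close_pairs b n) | uniq (all4 ef)].

Definition both_good b n (ef : ('I_n * 'I_n) * ('I_n * 'I_n)) : {set 'S_n} :=
  [set pi : 'S_n | same_block b (pi ef.1.1) (pi ef.1.2) && same_block b (pi ef.2.1) (pi ef.2.2)].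

(** Two distinct pairs, each listed in increasing order, that are not disjoint share exactly one
    point [x]; the four cases record its place in each pair. *)
Lemma overlappingP b n ef : ef \in overlapping b n ->
  exists x y z : 'I_n, [/\ uniq [:: x; y; z], same_block b x y, same_block b x z &
    [\/ ef = ((x, y), (x, z)), ef = ((x, y), (z, x)), ef = ((y, x), (x, z)) |
        ef = ((y, x), (z, x))]].
Proof.
case: ef => -[p q] [r s]; rewrite !inE /= => /andP[/andP[/andP[pq bpq] /andP[rs brs]]].
case/andP => ne nu.
have bqp : same_block b q p by rewrite /same_block eq_sym.
have bsr : same_block b s r by rewrite /same_block eq_sym.
have npq : p != q by rewrite neq_ltn pq.
have nrs : r != s by rewrite neq_ltn rs.
have nqp : q != p by rewrite eq_sym.
have nsr : s != r by rewrite eq_sym.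
have [e|pr] := eqVneq p r.
  subst r; exists p, q, s; split=> //; last by constructor 1.
  rewrite /= !inE !negb_or npq nrs /= andbT; apply: contraNneq ne => ->; exact: eqxx.
have [e|ps] := eqVneq p s.
  subst s; exists p, q, r; split=> //; last by constructor 2.
  rewrite /= !inE !negb_or npq pr /= andbT; apply: contraTneq pq => ->.
  by rewrite -leqNgt ltnW.
have [e|qr] := eqVneq q r.
  subst r; exists q, p, s; split=> //; last by constructor 3.
  by rewrite /= !inE !negb_or nqp nrs ps.
have [e|qs] := eqVneq q s.
  subst s; exists q, p, r; split=> //; last by constructor 4.
  by rewrite /= !inE !negb_or nqp qr pr.
by move: nu; rewrite /= !inE !negb_or npq pr ps qr qs nrs.
Qed.

Lemma card_overlapping b n : 0 < b -> #|overlapping b n| <= 4 * (n * b ^ 2).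
Proof.
move=> b_gt0.
pose c (t : 3.-tuple 'I_n) (i : nat) := tnth t (inord i).
pose g1 t := ((c t 0, c t 1), (c t 0, c t 2)).
pose g2 t := ((c t 0, c t 1), (c t 2, c t 0)).
pose g3 t := ((c t 1, c t 0), (c t 0, c t 2)).
pose g4 t := ((c t 1, c t 0), (c t 2, c t 0)).
pose W := clusters b n 2.
have sub : overlapping b n \subset (g1 @: W :|: g2 @: W) :|: (g3 @: W :|: g4 @: W).
  apply/subsetP => ef /overlappingP[x [y [z [_ xy xz]]]].
  have tC : [tuple x; y; z] \in W.
    by rewrite inE /thead (tnth_nth x) /= xy xz /same_block eqxx.
  rewrite !inE; case => ->; apply/orP; [left|left|right|right]; apply/orP;
    [left|right|left|right]; apply/imsetP; exists [tuple x; y; z] => //;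
    by rewrite ?/g1 ?/g2 ?/g3 ?/g4 /c !(tnth_nth x) /= !inordK.
apply: leq_trans (subset_leq_card sub) _.
have card_gW (g : 3.-tuple 'I_n -> ('I_n * 'I_n) * ('I_n * 'I_n)) : #|g @: W| <= n * b ^ 2.
  exact: leq_trans (leq_imset_card _ _) (card_clusters _ _ b_gt0).
apply: leq_trans (leq_card_setU _ _) _.
rewrite (_ : 4 * _ = (n * b ^ 2 + n * b ^ 2) + (n * b ^ 2 + n * b ^ 2)); last by lia.
by apply: leq_add; apply: leq_trans (leq_card_setU _ _) _; apply: leq_add; apply: card_gW.
Qed.

(** In all four cases of [overlappingP] the event puts the values of three points into one block, so
    [card_perm_block3] applies to each of the at most [4 n b^2] overlapping couples. *)
Lemma sum_overlapping b n : 0 < b ->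
  (\sum_(ef in overlapping b n) #|both_good b ef|) * n ^_ 3 <= n`! * (4 * (n * b ^ 2) ^ 2).
Proof.
move=> b_gt0; rewrite big_distrl /=.
apply: (@leq_trans (\sum_(ef in overlapping b n) n`! * (n * b ^ 2))).
  apply: leq_sum => ef /overlappingP[x [y [z [us _ _ def_ef]]]].
  apply: leq_trans (card_perm_block3 b_gt0 us); rewrite leq_mul2r; apply/orP; right.
  apply: subset_leq_card; apply/subsetP => pi; rewrite !inE.
  by case: def_ef => -> /=; rewrite /same_block ?[_ == pi x %/ b]eq_sym.
rewrite sum_nat_const mulnCA leq_mul2l -mulnn [4 * _]mulnA leq_mul ?orbT //.
exact: card_overlapping.
Qed.

(** Stated for a subset [D] so as to serve twice: with all disjoint couples for the second moment,
    and with those in one position block for the conflicts. *)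
Lemma sum_disjoint_pairs b n (D : {set ('I_n * 'I_n) * ('I_n * 'I_n)}) :
  D \subset disjoint_pairs b n ->
  (\sum_(ef in D) #|both_good b ef|) * n ^_ 4 <= n`! * (#|D| * #|block_mates b n| ^ 2).
Proof.
move=> /subsetP sD; rewrite big_distrl mulnCA -sum_nat_const /=.
apply: leq_sum => ef /sD; rewrite inE => /andP[_ us].
exact: card_perm_block22.
Qed.

Lemma card_disjoint_pairs b n : #|disjoint_pairs b n| <= #|close_pairs b n| ^ 2.
Proof.
rewrite -mulnn -cardsX subset_leq_card //; apply/subsetP => ef.
by rewrite inE => /andP[].
Qed.

Definition disjoint_pairs_block b n :=
  [set ef in disjoint_pairs b n | same_block b ef.1.1 ef.2.1].

Lemma card_disjoint_pairs_block b n : 0 < b -> #|disjoint_pairs_block b n| <= n * b ^ 3.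
Proof.
move=> b_gt0.
pose h (t : 4.-tuple 'I_n) :=
  ((tnth t (inord 0), tnth t (inord 1)), (tnth t (inord 2), tnth t (inord 3))).
apply: leq_trans (card_clusters n 3 b_gt0).
apply: leq_trans (leq_imset_card h _); apply/subset_leq_card/subsetP => -[[p q] [r s]].
rewrite !inE /= => /andP[/andP[/andP[/andP[_ pq] /andP[_ rs]] _] pr].
apply/imsetP; exists [tuple p; q; r; s]; last by rewrite /h !(tnth_nth p) /= !inordK.
rewrite inE /thead (tnth_nth p) /= pq pr; move: pq pr rs.
rewrite /same_block => /eqP-> /eqP-> /eqP->.
by rewrite eqxx.
Qed.

(** If both pairs are good and their left values share a block, then all four values lie in one
    block. *)
Lemma sum_disjoint_pairs_values b n : 0 < b ->
  (\sum_(ef in disjoint_pairs b n)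
     #|both_good b ef :&: [set pi : 'S_n | same_block b (pi ef.1.1) (pi ef.2.1)]|) * n ^_ 4
    <= n`! * (#|close_pairs b n| ^ 2 * (n * b ^ 3)).
Proof.
move=> b_gt0; rewrite big_distrl /=.
apply: (@leq_trans (\sum_(ef in disjoint_pairs b n) n`! * (n * b ^ 3))).
  apply: leq_sum => ef; rewrite inE => /andP[_ us].
  apply: leq_trans (card_perm_block4 b_gt0 us); rewrite leq_mul2r; apply/orP; right.
  apply: subset_leq_card; apply/subsetP => pi; rewrite !inE.
  by rewrite /same_block => /andP[/andP[/eqP <- /eqP <-] ->]; rewrite eqxx.
rewrite sum_nat_const mulnCA leq_mul2l leq_mul ?orbT //.
exact: card_disjoint_pairs.
Qed.

Lemma sum_card_exchange (I T : finType) (D : {set I}) (F : I -> {set T}) :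
  \sum_(i in D) #|F i| = \sum_(x : T) #|[set i in D | x \in F i]|.
Proof.
under eq_bigr => i _ do rewrite -sum1_card big_mkcond.
rewrite exchange_big; apply: eq_bigr => x _; rewrite -big_mkcondr -sum1_card.
by apply: eq_bigl => i; rewrite inE.
Qed.

Lemma sum_good_pairs b n :
  (\sum_(pi : 'S_n) #|good_pairs b pi|) * n ^_ 2 = n`! * (#|close_pairs b n| * #|block_mates b n|).
Proof.
have -> : \sum_(pi : 'S_n) #|good_pairs b pi| =
    \sum_(e in close_pairs b n) #|[set pi : 'S_n | same_block b (pi e.1) (pi e.2)]|.
  rewrite sum_card_exchange; apply: eq_bigr => pi _; apply: eq_card => e.
  by rewrite !inE.
rewrite big_distrl /= mulnCA -sum_nat_const; apply: eq_bigr => e.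
by rewrite inE => /andP[e12 _]; apply: card_perm_block2; rewrite neq_ltn e12.
Qed.

(** The square counts ordered couples of good pairs, which are equal, overlapping or disjoint. *)
Lemma sum_good_pairs_sq b n :
  \sum_(pi : 'S_n) #|good_pairs b pi| ^ 2 <=
  \sum_(pi : 'S_n) #|good_pairs b pi| + \sum_(ef in overlapping b n) #|both_good b ef| +
  \sum_(ef in disjoint_pairs b n) #|both_good b ef|.
Proof.
rewrite !sum_card_exchange -!big_split /=; apply: leq_sum => pi _.
pose sq := setX (good_pairs b pi) (good_pairs b pi).
have -> : #|good_pairs b pi| ^ 2 = #|sq| by rewrite cardsX mulnn.
pose diag := (fun e => (e, e)) @: good_pairs b pi.
have sub : sq \subset diag :|: [set ef in overlapping b n | pi \in both_good b ef]
    :|: [set ef in disjoint_pairs b n | pi \in both_good b ef].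
  apply/subsetP => -[e f]; rewrite in_setX /= => /andP[eg fg].
  move: (eg) (fg); rewrite !inE /= => /andP[-> ->] /andP[-> ->] /=; rewrite !andbT.
  have [->|_] := eqVneq e f.
    by rewrite /diag (imset_f (fun e => (e, e))).
  by rewrite -orbA orNb orbT.
apply: leq_trans (subset_leq_card sub) _.
apply: leq_trans (leq_card_setU _ _) _; rewrite leq_add2r.
apply: leq_trans (leq_card_setU _ _) _; rewrite leq_add2r.
exact: leq_imset_card.
Qed.

(** A conflict is either between overlapping pairs, or between disjoint pairs that share a position
    block or a value block. *)
Lemma sum_conflicts b n :
  \sum_(pi : 'S_n) #|conflicts b pi| <=
  \sum_(ef in overlapping b n) #|both_good b ef| +
  \sum_(ef in disjoint_pairs_block b n) #|both_good b ef| +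
  \sum_(ef in disjoint_pairs b n)
     #|both_good b ef :&: [set pi : 'S_n | same_block b (pi ef.1.1) (pi ef.2.1)]|.
Proof.
pose V (ef : ('I_n * 'I_n) * ('I_n * 'I_n)) : {set 'S_n} :=
  [set pi : 'S_n | same_block b (pi ef.1.1) (pi ef.2.1)].
rewrite !sum_card_exchange -!big_split /=; apply: leq_sum => pi _.
apply: (@leq_trans #|[set ef in overlapping b n | pi \in both_good b ef] :|:
  [set ef in disjoint_pairs_block b n | pi \in both_good b ef] :|:
  [set ef in disjoint_pairs b n | pi \in both_good b ef :&: V ef]|).
  apply/subset_leq_card/subsetP => -[e f]; rewrite !inE /=.
  case/andP => /andP[/andP[-> ->] /andP[-> ->]] /andP[-> c] /=; rewrite !andbT.
  by case/orP: c => ->; rewrite !andbT ?orNb // orbAC orNb.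
apply: leq_trans (leq_card_setU _ _) _; rewrite leq_add2r.
exact: leq_card_setU.
Qed.

Lemma card_block_mates b n : #|block_mates b n| = 2 * #|close_pairs b n|.
Proof.
pose sw (e : 'I_n * 'I_n) := (e.2, e.1).
have swK : involutive sw by case.
have -> : block_mates b n = close_pairs b n :|: sw @^-1: close_pairs b n.
  apply/setP => -[i j]; rewrite !inE /= neq_ltn andb_orl; congr (_ || _ && _).
  by rewrite /same_block eq_sym.
have dis : close_pairs b n :&: sw @^-1: close_pairs b n = set0.
  by apply/setP => -[i j]; rewrite !inE /=; lia.
by rewrite cardsU dis cards0 (card_preimset _ (inv_inj swK)) subn0 mul2n addnn.
Qed.

Lemma card_block_mates_le b n : 0 < b -> #|block_mates b n| <= n * b.
Proof.
move=> b_gt0; apply: leq_trans (card_clusters n 1 b_gt0).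
pose h (t : 2.-tuple 'I_n) := (tnth t (inord 0), tnth t (inord 1)).
apply: leq_trans (leq_imset_card h _); apply/subset_leq_card/subsetP => -[p q].
rewrite !inE /= => /andP[_ pq]; apply/imsetP; exists [tuple p; q].
  by rewrite inE /thead (tnth_nth p) /= pq /same_block eqxx.
by rewrite /h !(tnth_nth p) /= !inordK.
Qed.

(** Only the [n %/ b] full blocks are used, each with [b (b - 1)] ordered pairs. Replacing [b - 1]
    by [b / 2] and the total length of the full blocks by [n / 2] loses the factor 4. *)
Lemma card_block_mates_ge b n : 1 < b -> b.*2 <= n -> n * b <= 4 * #|block_mates b n|.
Proof.
move=> b_gt1 bn; have b_gt0 := ltnW b_gt1.
(* The point [pos k u] is the one at offset [u] in the full block [k]. *)
have lt_pos (k : 'I_(n %/ b)) (u : 'I_b) : k * b + u < n.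
  have := leq_trunc_div n b; have := ltn_ord k; have := ltn_ord u; nia.
pose pos k u : 'I_n := Ordinal (lt_pos k u).
pose off := [set uv : 'I_b * 'I_b | uv.1 != uv.2].
have card_off : #|off| = b * b.-1.
  have := cardsC off; rewrite card_prod !card_ord.
  have -> : ~: off = (fun u => (u, u)) @: 'I_b.
    apply/setP => -[u v]; rewrite !inE negbK; apply/eqP/imsetP => [/= ->|[w _ [-> ->]]//].
    by exists v.
  by rewrite card_imset ?card_ord => [|u v []//]; nia.
pose h (kuv : 'I_(n %/ b) * ('I_b * 'I_b)) := (pos kuv.1 kuv.2.1, pos kuv.1 kuv.2.2).
have posE k u : (pos k u %/ b = k) * (pos k u %% b = u).
  by rewrite /= divnMDl // modnMDl (divn_small (ltn_ord u)) (modn_small (ltn_ord u)) addn0.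
have pos_inj k u k' u' : pos k u = pos k' u' -> k = k' /\ u = u'.
  by move=> e; split; apply/val_inj => /=; have := posE k u; rewrite e !posE => -[].
have h_inj : injective h.
  move=> [k [u v]] [k' [u' v']] hh.
  by have /pos_inj[/= -> ->] := congr1 fst hh; have /pos_inj[_ /= ->] := congr1 snd hh.
have : #|h @: setX setT off| <= #|block_mates b n|.
  apply/subset_leq_card/subsetP => _ /imsetP[[k [u v]] + ->].
  rewrite !inE /= => uv; rewrite /same_block !posE eqxx andbT.
  by apply: contra uv => /eqP/pos_inj[_ ->].
rewrite card_imset // cardsX cardsT card_ord card_off.
have := divn_eq n b; have := ltn_pmod n b_gt0.
set q := n %/ b; set r := n %% b; set m := #|_| => rb nE.
have b2 : b <= 2 * b.-1 by lia.
have n2 : n <= 2 * (q * b) by lia.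
by have := leq_mul n2 b2; lia.
Qed.

(** * Real-valued moment estimates and the lower tail *)

Import Order.TTheory GRing.Theory Num.Theory.
Local Open Scope ring_scope.

Lemma ler_of_mul_le (R : realFieldType) (x y z c : R) :
  0 < z -> z <= y -> 0 <= c -> x * y <= c * z -> x <= c.
Proof.
move=> z0 zy c0 xy; have y0 := lt_le_trans z0 zy.
by rewrite -(ler_pM2r y0) (le_trans xy) // ler_wpM2l.
Qed.

Lemma mean_good_pairs_ge (R : realFieldType) (n b P V : R) :
  1 < n -> 0 <= b -> V = 2 * P -> n * b <= 4 * V ->
  b ^+ 2 / 32 <= P * V / (n * (n - 1)).
Proof.
move=> n1 b0 VE Vge.
have nb0 : 0 <= n * b by apply: mulr_ge0 => //; lra.
have nn0 : 0 < n * (n - 1) by apply: mulr_gt0; lra.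
rewrite ler_pdivlMr //.
have h : 0 <= n * b / 8 by lra.
have h' : 0 <= n * b / 4 by lra.
have e : n * b / 8 <= P by lra.
have e' : n * b / 4 <= V by lra.
have PV := ler_pM h h' e e'.
have : 0 <= b ^+ 2 / 32 * n by rewrite mulr_ge0 ?divr_ge0 ?exprn_ge0; lra.
lra.
Qed.

(** Here [t], [g], [y] stand for the twin length and the numbers of good pairs and conflicts. If
    [t < mu / 4], then either [y] is at least [mu / 4], and the Markov term reaches 1, or [g] falls
    short of [mu] by at least [mu / 2], and the Chebyshev term does. *)
Lemma markov_chebyshev_indicator (R : realFieldType) (mu t g y : R) :
  0 < mu -> 0 <= y -> t < mu / 4 -> g <= t + y ->
  1 <= 4 / mu ^+ 2 * (g - mu) ^+ 2 + 4 / mu * y.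
Proof.
move=> mu0 y0 tmu gty.
have muV0 : 0 <= 4 / mu by rewrite divr_ge0 // ltW.
have g0 : 0 <= 4 / mu ^+ 2 * (g - mu) ^+ 2.
  by rewrite mulr_ge0 ?sqr_ge0 // divr_ge0 ?sqr_ge0.
have [ybig|ysmall] := lerP (mu / 4) y.
  apply: ler_wpDl => //; rewrite mulrAC ler_pdivlMr // mul1r; lra.
apply: ler_wpDr; first exact: mulr_ge0.
rewrite mulrAC ler_pdivlMr ?exprn_gt0 // mul1r.
have gap : mu / 2 <= mu - g by lra.
have half0 : 0 <= mu / 2 by lra.
have := ler_pM half0 half0 gap gap; lra.
Qed.

(** All sums run over the [M] permutations: [SG], [SG2] are the first two moments of the number of
    good pairs, and [SY] is the total number of conflicts. [P] and [V] count close pairs and block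
    mates; [O], [D], [Dp], [Dv] are the contributions of overlapping couples, disjoint couples, and
    disjoint couples sharing a position or a value block. *)
Lemma moment_bound (R : realFieldType) (n b P V M SG SG2 SY O D Dp Dv mu : R) :
  8 <= n -> 2 <= b -> 0 < M -> V = 2 * P -> V <= n * b -> n * b <= 4 * V ->
  mu = P * V / (n * (n - 1)) ->
  SG * (n * (n - 1)) = M * (P * V) ->
  O * (n * (n - 1) * (n - 2)) <= M * (4 * (n * b ^+ 2) ^+ 2) ->
  D * (n * (n - 1) * (n - 2) * (n - 3)) <= M * (P ^+ 2 * V ^+ 2) ->
  Dp * (n * (n - 1) * (n - 2) * (n - 3)) <= M * (n * b ^+ 3 * V ^+ 2) ->
  Dv * (n * (n - 1) * (n - 2) * (n - 3)) <= M * (P ^+ 2 * (n * b ^+ 3)) ->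
  SG2 <= SG + O + D -> SY <= O + Dp + Dv ->
  4 / mu ^+ 2 * (SG2 - 2 * mu * SG + M * mu ^+ 2) + 4 / mu * SY
    <= M * (200 ^+ 2 * (b ^- 2 + b ^+ 3 / n)).
Proof.
move=> n8 b2 M0 VE Vle Vge muE SGE Ole Dle Dple Dvle SG2le SYle.
have n0 : 0 < n by lra.
have b0 : 0 < b by lra.
have n_3 : n ^+ 3 / 2 <= n * (n - 1) * (n - 2).
  have : 0 <= n * (n ^+ 2 / 2 - 3 * n + 2) by rewrite mulr_ge0 //; nra.
  lra.
have n_4 : n ^+ 4 / 4 <= n * (n - 1) * (n - 2) * (n - 3).
  have e1 : n ^+ 2 / 2 <= (n - 1) * (n - 3) by nra.
  have e2 : n ^+ 2 / 2 <= n * (n - 2) by nra.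
  have e3 : 0 <= n ^+ 2 / 2 by nra.
  have := ler_pM e3 e3 e1 e2; lra.
have nb0 : 0 < n * b by rewrite mulr_gt0.
have V0 : 0 < V by lra.
have P0 : 0 < P by lra.
have nn0 : 0 < n * (n - 1) by rewrite mulr_gt0 //; lra.
have mu0 : 0 < mu by rewrite muE; apply: divr_gt0 => //; apply: mulr_gt0.
have n1 : 1 < n by lra.
have muge : b ^+ 2 / 32 <= mu by rewrite muE mean_good_pairs_ge // ltW.
have SG_mu : SG = M * mu by rewrite muE mulrA -SGE mulfK ?gt_eqF.
have n_neq0 : n != 0 by rewrite gt_eqF.
have b_neq0 : b != 0 by rewrite gt_eqF.
have mu_neq0 : mu != 0 by rewrite gt_eqF.
have M_neq0 : M != 0 by rewrite gt_eqF.
have n3_gt0 : 0 < n ^+ 3 / 2 by rewrite divr_gt0 ?exprn_gt0.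
have n4_gt0 : 0 < n ^+ 4 / 4 by rewrite divr_gt0 ?exprn_gt0.
have b_pow k : 0 <= b ^+ k by rewrite exprn_ge0 // ltW.
have Mc c : 0 <= c -> 0 <= M * c by move=> c0; rewrite mulr_ge0 // ltW.
have nV : 0 <= n^-1 by rewrite invr_ge0 ltW.
have O_le : O <= M * (8 * b ^+ 4 / n).
  apply: (ler_of_mul_le n3_gt0 n_3); first by apply: Mc; do ![apply: mulr_ge0 => //].
  by apply: le_trans Ole _; rewrite le_eqVlt; apply/orP; left; apply/eqP; field.
have Dp_le : Dp <= M * (4 * b ^+ 5 / n).
  apply: (ler_of_mul_le n4_gt0 n_4); first by apply: Mc; do ![apply: mulr_ge0 => //].
  apply: le_trans Dple _.
  rewrite (_ : M * (4 * _ / n) * _ = M * (n * b ^+ 3 * (n * b) ^+ 2)); last by field.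
  by rewrite ler_pM2l // ler_pM2l ?mulr_gt0 ?exprn_gt0 // ler_sqr ?nnegrE ?(ltW V0) ?(ltW nb0).
have Dv_le : Dv <= M * (b ^+ 5 / n).
  apply: (ler_of_mul_le n4_gt0 n_4); first by apply: Mc; do ![apply: mulr_ge0 => //].
  apply: le_trans Dvle _.
  rewrite (_ : M * (_ / n) * _ = M * ((n * b / 2) ^+ 2 * (n * b ^+ 3))); last by field.
  rewrite ler_pM2l // ler_pM2r ?mulr_gt0 ?exprn_gt0 // ler_sqr ?nnegrE; lra.
(* The leading constant must be 1 here, since [M * mu ^+ 2] has to cancel in the variance; the other
   contributions may lose constant factors. The ratio of [n (n - 1)] to [(n - 2) (n - 3)] is at most
   [1 + 8 / n] once [n] is at least 8. *)
have D_le : D <= M * (mu ^+ 2 * (1 + 8 / n)).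
  have d0 : 0 < n * (n - 1) * (n - 2) * (n - 3) by exact: lt_le_trans n_4.
  rewrite -(ler_pM2r d0); apply: le_trans Dle _.
  have -> : P ^+ 2 * V ^+ 2 = mu ^+ 2 * (n * (n - 1)) ^+ 2.
    by rewrite -!exprMn; congr (_ ^+ 2); rewrite muE divfK ?gt_eqF.
  rewrite -[leRHS]mulrA ler_pM2l // -[leRHS]mulrA ler_pM2l ?exprn_gt0 //.
  rewrite (_ : _ * (_ * _) = n * (n - 1) * ((n + 8) * ((n - 2) * (n - 3)) / n)); last by field.
  rewrite expr2 ler_pM2l // ler_pdivlMr //; nra.
have step : 4 / mu ^+ 2 * (SG2 - 2 * mu * SG + M * mu ^+ 2) + 4 / mu * SY <=
    4 / mu ^+ 2 * (M * mu + M * (8 * b ^+ 4 / n) + M * (mu ^+ 2 * (8 / n))) +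
    4 / mu * (M * (8 * b ^+ 4 / n) + M * (5 * b ^+ 5 / n)).
  apply: lerD; rewrite ler_pM2l ?divr_gt0 ?exprn_gt0 //.
    rewrite SG_mu; rewrite SG_mu in SG2le; move: D_le O_le; set w := n^-1 => D_le O_le; lra.
  move: O_le Dp_le Dv_le; set w := n^-1 => O_le Dp_le Dv_le; lra.
apply: le_trans step _.
have muV : mu^-1 <= 32 / b ^+ 2.
  rewrite -[leRHS]invrK lef_pV2 ?posrE ?invr_gt0 ?divr_gt0 ?exprn_gt0 //.
  by rewrite invf_div.
have muV0 : 0 <= mu^-1 by rewrite invr_ge0 ltW.
have muV2 : mu^-1 ^+ 2 <= (32 / b ^+ 2) ^+ 2 by rewrite ler_sqr ?nnegrE //; apply: divr_ge0.
rewrite [leLHS](_ : _ = M * (4 * mu^-1 + 32 * mu^-1 ^+ 2 * (b ^+ 4 / n) + 32 / n +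
   mu^-1 * (32 * b ^+ 4 / n + 20 * b ^+ 5 / n))); last by field; apply/andP.
rewrite ler_pM2l //.
(* With [mu^-1] at most [32 / b^2], the coefficient of [b^-2] becomes 128 and that of [b^3 / n]
   becomes 32768 + 32 + 1024 + 640 = 34464, both below [200^2]. *)
have t1 : mu^-1 ^+ 2 * (b ^+ 4 / n) <= 32 ^+ 2 / n.
  apply: le_trans (ler_wpM2r _ muV2) _; first by apply: mulr_ge0.
  by rewrite le_eqVlt; apply/orP; left; apply/eqP; field; apply/andP.
have t2 : mu^-1 * (32 * b ^+ 4 / n + 20 * b ^+ 5 / n) <= 32 * (32 * b ^+ 2 / n + 20 * b ^+ 3 / n).
  apply: le_trans (ler_wpM2r _ muV) _; first by apply: addr_ge0; do ![apply: mulr_ge0 => //].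
  by rewrite le_eqVlt; apply/orP; left; apply/eqP; field; apply/andP.
have b_ge1 : 1 <= b by lra.
have b1 : 1 / n <= b ^+ 3 / n by rewrite ler_wpM2r // exprn_ege1.
have b23 : b ^+ 2 / n <= b ^+ 3 / n.
  by rewrite ler_wpM2r // [leRHS]exprS ler_peMl.
have bV : 0 <= b ^- 2 by rewrite invr_ge0.
have b3n : 0 <= b ^+ 3 / n by rewrite mulr_ge0.
move: t1 t2 b1 b23 b3n muV; rewrite -!mulrA; set w := b ^+ 3 * n^-1.
set w2 := b ^+ 2 * n^-1; set w5 := b ^+ 5 * n^-1; set w4 := b ^+ 4 * n^-1; set nv := n^-1.
move=> t1 t2 b1 b23 b3n muV; move: bV t1 t2 b1 b23 b3n muV; clear; lra.
Qed.

(** The threshold [b^2 / 128] is a quarter of the lower bound [b^2 / 32] for the mean [mu], as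
    [markov_chebyshev_indicator] requires. *)
Lemma twin_length_lower_tail (R : realFieldType) n b :
  (1 < b)%N -> (b.*2 <= n)%N -> (8 <= n)%N ->
  #|[set pi : 'S_n | (128 * twin_length pi < b ^ 2)%N]|%:R / n`!%:R
    <= 200 ^+ 2 * (b%:R ^- 2 + b%:R ^+ 3 / n%:R) :> R.
Proof.
move=> b_gt1 bn n8; have b_gt0 := ltnW b_gt1.
set bad := [set pi | _].
pose M : R := n`!%:R; pose nR : R := n%:R; pose bR : R := b%:R.
pose P : R := #|close_pairs b n|%:R; pose V : R := #|block_mates b n|%:R.
pose mu := P * V / (nR * (nR - 1)).
pose G (pi : 'S_n) : R := #|good_pairs b pi|%:R.
pose Y (pi : 'S_n) : R := #|conflicts b pi|%:R.
have n8R : 8 <= nR by rewrite ler_nat.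
have b2R : 2 <= bR by rewrite ler_nat.
have M0 : 0 < M by rewrite ltr0n fact_gt0.
have VE : V = 2 * P by rewrite /V card_block_mates natrM.
have Vle : V <= nR * bR by rewrite -natrM ler_nat card_block_mates_le.
have Vge : nR * bR <= 4 * V by rewrite -!natrM ler_nat card_block_mates_ge.
have nbR0 : 0 < nR * bR by rewrite mulr_gt0; lra.
have mu0 : 0 < mu.
  by apply: divr_gt0; apply: mulr_gt0; lra.
have muge : bR ^+ 2 / 32 <= mu.
  by rewrite mean_good_pairs_ge ?ler0n //; apply: lt_le_trans n8R; rewrite ltr1n.
have nk k : (k <= 8)%N -> (n - k)%:R = nR - k%:R by move=> k8; rewrite natrB //; lia.
have ff2 : (n ^_ 2)%:R = nR * (nR - 1) by rewrite !ffactnSr ffactn0 mul1n subn0 natrM nk.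
have ff3 : (n ^_ 3)%:R = nR * (nR - 1) * (nR - 2) by rewrite ffactnSr natrM ff2 nk.
have ff4 : (n ^_ 4)%:R = nR * (nR - 1) * (nR - 2) * (nR - 3) by rewrite ffactnSr natrM ff3 nk.
pose O : R := (\sum_(ef in overlapping b n) #|both_good b ef|)%:R.
pose D : R := (\sum_(ef in disjoint_pairs b n) #|both_good b ef|)%:R.
pose Dp : R := (\sum_(ef in disjoint_pairs_block b n) #|both_good b ef|)%:R.
pose Dv : R := (\sum_(ef in disjoint_pairs b n)
   #|both_good b ef :&: [set pi : 'S_n | same_block b (pi ef.1.1) (pi ef.2.1)]|)%:R.
have SGE : (\sum_pi G pi) * (nR * (nR - 1)) = M * (P * V).
  by rewrite -natr_sum -ff2 -!natrM sum_good_pairs.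
have Ole : O * (nR * (nR - 1) * (nR - 2)) <= M * (4 * (nR * bR ^+ 2) ^+ 2).
  by rewrite -ff3 -!(natrM, natrX) ler_nat sum_overlapping.
have Dle : D * (nR * (nR - 1) * (nR - 2) * (nR - 3)) <= M * (P ^+ 2 * V ^+ 2).
  rewrite -ff4 -!(natrM, natrX) ler_nat.
  apply: leq_trans (sum_disjoint_pairs (subxx _)) _.
  by rewrite leq_mul2l leq_mul ?card_disjoint_pairs ?orbT.
have Dple : Dp * (nR * (nR - 1) * (nR - 2) * (nR - 3)) <= M * (nR * bR ^+ 3 * V ^+ 2).
  rewrite -ff4 -!(natrM, natrX) ler_nat.
  have sub : disjoint_pairs_block b n \subset disjoint_pairs b n.
    by apply/subsetP => ef; rewrite inE => /andP[].
  apply: leq_trans (sum_disjoint_pairs sub) _.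
  by rewrite leq_mul2l leq_mul ?card_disjoint_pairs_block ?orbT.
have Dvle : Dv * (nR * (nR - 1) * (nR - 2) * (nR - 3)) <= M * (P ^+ 2 * (nR * bR ^+ 3)).
  by rewrite -ff4 -!(natrM, natrX) ler_nat sum_disjoint_pairs_values.
have SG2le : \sum_pi G pi ^+ 2 <= \sum_pi G pi + O + D.
  rewrite (eq_bigr (fun pi => (#|good_pairs b pi| ^ 2)%:R)); last by move=> pi _; rewrite natrX.
  by rewrite -!natr_sum -!natrD ler_nat sum_good_pairs_sq.
have SYle : \sum_pi Y pi <= O + Dp + Dv.
  by rewrite -!natr_sum -!natrD ler_nat sum_conflicts.
have := moment_bound n8R b2R M0 VE Vle Vge (erefl mu) SGE Ole Dle Dple Dvle SG2le SYle.
rewrite ler_pdivrMr // [_ * n`!%:R]mulrC; apply: le_trans.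
have -> : 4 / mu ^+ 2 * (\sum_pi G pi ^+ 2 - 2 * mu * (\sum_pi G pi) + M * mu ^+ 2) +
    4 / mu * (\sum_pi Y pi) = \sum_pi (4 / mu ^+ 2 * (G pi - mu) ^+ 2 + 4 / mu * Y pi).
  rewrite big_split /= -!mulr_sumr; congr (_ * _ + _).
  rewrite (_ : M * mu ^+ 2 = \sum_(pi : 'S_n) mu ^+ 2); last first.
    by rewrite sumr_const card_permT card_ord mulr_natl.
  rewrite mulr_sumr -sumrB -big_split /=; apply: eq_bigr => pi _.
  by ring.
(* The indicator of a bad permutation is bounded pointwise by the summand. *)
rewrite -sum1_card natr_sum big_mkcond /=; apply: ler_sum => pi _.
have Y0 : 0 <= Y pi by exact: ler0n.
case: ifP => [|_]; last first.
  apply: addr_ge0; apply: mulr_ge0 => //.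
  - exact: divr_ge0 (ler0n _ _) (sqr_ge0 _).
  - exact: sqr_ge0.
  - exact: divr_ge0 (ler0n _ _) (ltW mu0).
rewrite inE => lt_t; apply: (@markov_chebyshev_indicator _ _ (twin_length pi)%:R) => //; last first.
  by rewrite -natrD ler_nat card_good_pairs_le.
have tR : 128 * (twin_length pi)%:R < bR ^+ 2 by rewrite -natrX -natrM ltr_nat.
move: tR muge; clear; lra.
Qed.

(** * Asymptotics *)

From mathcomp Require Import all_classical all_reals all_analysis.
Import numFieldNormedType.Exports.
Local Open Scope classical_set_scope.

(** With [k] the least integer above [8 x^2], [k^3] is at least [512 n^2], so [card_twin_length_ge]
    applies; its bound [2^-k] is weakened to [1 / k]. *)
Lemma twin_length_upper_tail (R : realType) n (x : R) :
  (0 < n)%N -> 0 < x -> x ^+ 3 = n%:R ->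
  #|[set pi : 'S_n | 8 * x ^+ 2 < (twin_length pi)%:R]%SET|%:R / n`!%:R <= x ^- 2.
Proof.
move=> n_gt0 x0 xn.
have x2 : 0 <= 8 * x ^+ 2 by rewrite mulr_ge0 // sqr_ge0.
have /andP[kl ku] := truncn_itv x2.
set k := (Num.truncn (8 * x ^+ 2)).+1 in ku.
have sub : [set pi : 'S_n | 8 * x ^+ 2 < (twin_length pi)%:R]%SET
    \subset [set pi : 'S_n | (k <= twin_length pi)%N]%SET.
  apply/fintype.subsetP => pi; rewrite !inE => lt_t.
  by rewrite /k -(ltr_nat R); apply: le_lt_trans lt_t.
have nk : (128 * n ^ 2 <= k ^ 3)%N.
  rewrite -(ler_nat R) !(natrM, natrX) -xn.
  have : (8 * x ^+ 2) ^+ 3 <= k%:R ^+ 3 :> R by rewrite lerXn2r ?nnegrE // ltW.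
  have : 0 <= x ^+ 6 by rewrite exprn_ge0 // ltW.
  lra.
have tail := card_twin_length_ge n_gt0 nk.
have M0 : (0 : R) < n`!%:R by rewrite ltr0n fact_gt0.
have k0 : (0 : R) < k%:R by rewrite ltr0n.
apply: (@le_trans _ _ (k%:R^-1)); last first.
  rewrite lef_pV2 ?posrE ?exprn_gt0 //; apply: le_trans (ltW ku).
  have := sqr_ge0 x; lra.
rewrite ler_pdivrMr // [leRHS]mulrC ler_pdivlMr // -natrM ler_nat.
apply: leq_trans tail; apply: leq_mul; first exact: subset_leq_card.
exact/ltnW/ltn_expl.
Qed.

(** In the application [u] is the cube root of [n] and [w] the sixth root of [ln n]; the block
    length is the integer part of [u / w]. The error terms [b^-2], [b^3 / n] and [u^-2] are then all
    of order at most [1 / w]. *)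
Lemma twin_length_tails (R : realType) n (u w : R) :
  u ^+ 3 = n%:R -> 2 <= w -> w ^+ 6 <= 3 * u ->
  #|[set pi : 'S_n | ~~ ((u / w) ^+ 2 / 8 ^+ 3 <= (twin_length pi)%:R <= 8 * u ^+ 2)]%SET|%:R
     / n`!%:R <= 200 ^+ 3 / w.
Proof.
move=> un w2 wu.
have w0 : 0 < w by lra.
have w1 : 1 <= w by lra.
have w12 : 0 < w / 12 by lra.
have w62 : 32 * w <= w ^+ 6.
  have : 2 ^+ 5 <= w ^+ 5 by rewrite lerXn2r ?nnegrE //; lra.
  by move=> h; have := ler_wpM2r (ltW w0) h; rewrite -exprSr; lra.
have uw : 10 * w <= u by lra.
have u20 : 20 <= u by lra.
have u0 : 0 < u by lra.
have un2 : u * u <= n%:R.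
  rewrite -un exprS expr2 ler_pM2l //; nra.
set s := u / w.
have su : s <= u / 2 by rewrite /s ler_pM2l // lef_pV2 ?posrE.
have s10 : 10 <= s by rewrite ler_pdivlMr.
have s0 : 0 <= s by lra.
have /andP[bl bu] := truncn_itv s0.
set b := Num.truncn s in bl bu.
have bu' : s < b%:R + 1 by rewrite natr1.
have b_gt1 : (1 < b)%N by rewrite -(ltr_nat R); lra.
have b0 : (0 : R) < b%:R by lra.
have sb : s <= 2 * b%:R by move: bu' b_gt1; rewrite -(ltr_nat R); clear; lra.
have s2b2 : s ^+ 2 <= (2 * b%:R) ^+ 2.
  by rewrite lerXn2r ?nnegrE // mulr_ge0 // ltW.
have n_big : 8 <= n%:R :> R by nra.
have nR0 : 0 < n%:R :> R by lra.
have n8 : (8 <= n)%N by rewrite -(ler_nat R).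
have bn : (b.*2 <= n)%N by rewrite -(ler_nat R) -muln2 natrM; nra.
have lower := @twin_length_lower_tail R n b b_gt1 bn n8.
have n_gt0 : (0 < n)%N by apply: leq_trans n8.
have upper := twin_length_upper_tail n_gt0 u0 un.
have M0 : (0 : R) < n`!%:R by rewrite ltr0n fact_gt0.
have sub : [set pi : 'S_n | ~~ (s ^+ 2 / 8 ^+ 3 <= (twin_length pi)%:R <= 8 * u ^+ 2)]%SET \subset
   ([set pi : 'S_n | (128 * twin_length pi < b ^ 2)%N] :|:
   [set pi : 'S_n | 8 * u ^+ 2 < (twin_length pi)%:R])%SET.
  apply/fintype.subsetP => pi; rewrite !inE negb_and -!ltNge => /orP[lt_t|->]; last by rewrite orbT.
  (* Rounding gives [s <= 2 b], so [s^2 / 512] is at most [b^2 / 128]: this is where the constant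
     [8 ^+ 3] comes from. *)
  apply/orP; left; rewrite -(ltr_nat R) natrM natrX.
  by move: lt_t s2b2; set t := (twin_length pi)%:R; clear; lra.
have le_card := leq_trans (subset_leq_card sub) (leq_card_setU _ _).
apply: (@le_trans _ _ (200 ^+ 2 * (b%:R ^- 2 + b%:R ^+ 3 / n%:R) + u ^- 2)).
  apply: le_trans (lerD lower upper).
  by rewrite -mulrDl ler_pM2r ?invr_gt0 // -natrD ler_nat.
have wV0 : 0 < w^-1 by rewrite invr_gt0.
have wV1 : w^-1 <= 1 by rewrite invf_le1.
have uV : u^-1 <= w^-1 / 10.
  by rewrite -invfM lef_pV2 ?posrE ?mulr_gt0 // mulrC.
have uV0 : 0 <= u^-1 by rewrite invr_ge0 ltW.
have e1 : u ^- 2 <= w^-1.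
  by rewrite -exprVn expr2; move: uV uV0 wV0 wV1; clear; nra.
have e2 : b%:R ^- 2 <= 12 * w^-1.
  rewrite -[leRHS](_ : (w / 12)^-1 = _); last by rewrite invf_div.
  rewrite lef_pV2 ?posrE ?exprn_gt0 //.
  (* After multiplication by [w^2] this follows from [w^3 <= w^6 <= 3 u <= 3 u^2]. *)
  have w3 : w <= 3 * s ^+ 2.
    rewrite -(ler_pM2r (_ : 0 < w ^+ 2)) ?exprn_gt0 // -mulrA -exprMn divfK ?gt_eqF //.
    have : w ^+ 3 <= w ^+ 6 by rewrite ler_weXn2l.
    by rewrite -exprS; move: wu u20; clear; nra.
  by move: w3 s2b2; clear; lra.
have e3 : b%:R ^+ 3 / n%:R <= w^-1.
  rewrite ler_pdivrMr //.
  have : b%:R ^+ 3 <= s ^+ 3 by rewrite lerXn2r ?nnegrE.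
  move/le_trans; apply; rewrite /s expr_div_n un mulrC ler_pM2r //.
  by rewrite -exprVn exprS -[leRHS]mulr1 ler_pM2l // exprn_ile1 // ltW.
move: e1 e2 e3 wV0; clear; lra.
Qed.

Theorem theorem2p2 (R : realType) :
  exists c C : R, 0 < c /\ 0 < C /\
    (fun n : nat =>
       uniform_proba R (fun pi : 'S_n =>
         c * (n%:R `^ (2 / 3) / (ln n%:R) `^ (1 / 3)) <= (twin_length pi)%:R
           <= C * n%:R `^ (2 / 3))) @ \oo --> (1 : R).
Proof.
exists ((8 ^+ 3)^-1), 8; split; first by rewrite invr_gt0 exprn_gt0.
split; first exact: ltr0n.
apply/cvgrPdist_le => eps eps0.
near=> n.
pose u : R := n%:R `^ (1 / 3); pose w : R := (ln n%:R) `^ (1 / 6).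
(* This makes [w] at least [2 + 200^3 / eps]: the 2 meets a hypothesis of [twin_length_tails], and
   the rest brings its bound [200^3 / w] below [eps]. *)
have n_ge : expR ((2 + 200 ^+ 3 / eps) ^+ 6) <= n%:R :> R.
  by near: n; apply: nbhs_infty_ger.
set B := 2 + 200 ^+ 3 / eps in n_ge.
have B2 : 2 <= B by rewrite lerDl divr_ge0 ?exprn_ge0 ?ler0n // ltW.
have n_gt0 : (0 : R) < n%:R by apply: lt_le_trans n_ge; exact: expR_gt0.
have L_ge : B ^+ 6 <= ln n%:R by rewrite -ler_expR lnK // posrE.
have L0 : 0 <= ln (n%:R : R) by apply: le_trans L_ge; rewrite exprn_ge0; lra.
have un : u ^+ 3 = n%:R.
  by rewrite -powR_mulrn ?powR_ge0 // -powRrM divfK ?powRr1 ?ler0n ?pnatr_eq0.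
have wL : w ^+ 6 = ln n%:R.
  by rewrite -powR_mulrn ?powR_ge0 // -powRrM divfK ?powRr1 ?pnatr_eq0.
have wB : B <= w.
  by rewrite -(@ler_pXn2r _ 6) ?nnegrE ?powR_ge0 ?wL //; lra.
have wu : w ^+ 6 <= 3 * u.
  (* The inequality between [1 + x] and [expR x] at [x = ln n / 3], where the exponential is [u]. *)
  rewrite wL; have := expR_ge1Dx (ln n%:R / 3 : R).
  rewrite (_ : expR _ = u); first by lra.
  by rewrite /u /powR gt_eqF // mulrC div1r.
have w2 : 2 <= w by lra.
have := twin_length_tails un w2 wu.
have -> : 8 * n%:R `^ (2 / 3) = 8 * u ^+ 2 :> R.
  by rewrite /u -powR_mulrn ?powR_ge0 // -powRrM mulrAC mul1r.
have -> : (8 ^+ 3)^-1 * (n%:R `^ (2 / 3) / (ln n%:R) `^ (1 / 3)) = (u / w) ^+ 2 / 8 ^+ 3 :> R.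
  rewrite mulrC expr_div_n /u /w -!powR_mulrn ?powR_ge0 // -!powRrM.
  by congr (_ `^ _ / _ `^ _ / _); field.
set bad := [set pi | _]%SET => bad_le.
set good := (fun pi : 'S_n => _).
(* Passing to the complement turns the distance to the limit 1 into the probability of [bad]. *)
have -> : uniform_proba R good = 1 - #|bad|%:R / n`!%:R.
  have card_good : (#|good| + #|bad|)%N = n`!.
    rewrite -[n in RHS]card_ord -card_permT -(cardC good); congr (_ + _)%N.
    by apply: eq_card => pi; rewrite !inE.
  have M0 : n`!%:R != 0 :> R by rewrite pnatr_eq0 -lt0n fact_gt0.
  rewrite /uniform_proba card_permT card_ord; apply: (mulIf M0).
  by rewrite mulrBl !divfK // mul1r -card_good natrD addrK.
rewrite opprB addrCA subrr addr0 ger0_norm ?divr_ge0 ?ler0n //.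
apply: le_trans bad_le _.
rewrite ler_pdivrMr; last by lra.
have : 200 ^+ 3 / eps <= w by apply: le_trans wB; rewrite lerDr.
by rewrite ler_pdivrMr // [w * eps]mulrC.
Unshelve. all: by end_near.
Qed.
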